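(* Consider a solution candidate of negative elliptic form, i.e. functions $w_i=r_i(t)\cos[\alpha(t)+a_i]$, $x_i=r_i(t)\sin[\alpha(t)+a_i]$, $y_i=y_i(t)$, $z_i=z_i(t)$, $i=1,\dots,N$, with $a_i$ constants, $\alpha$ a nonconstant function, $z_i\ge1$ and $r_i^2+y_i^2-z_i^2=-1$. It is a negative elliptic rotopulsator of the curved $N$-body problem in $\mathbb H^3$ if and only if $$\dot\alpha=\frac{b}{\sum_{j=1}^Nm_jr_j^2},$$ where $b\ne0$ is a constant, there are at least two distinct indices $i,j\in\{1,\dots,N\}$ such that $q_{ij}$ is not constant, and the variables $y_i,z_i,r_i$, $i=1,\dots,N$, satisfy the first-order system of $5N$ equations (with $N$ constraints: $r_i^2+y_i^2=z_i^2-1$, $i=1,\dots,N$) $$\begin{cases}\dot y_i=u_i\\ \dot z_i=v_i\\ \dot u_i=\sum_{j\ne i}\frac{m_j(y_j+q_{ij}y_i)}{(q_{ij}^2-1)^{3/2}}+H_i(\mathbf y,\mathbf z,u_i,v_i)\,y_i\\ \dot v_i=\sum_{j\ne i}\frac{m_j(z_j+q_{ij}z_i)}{(q_{ij}^2-1)^{3/2}}+H_i(\mathbf y,\mathbf z,u_i,v_i)\,z_i\\ r_i\ddot\alpha+2\dot r_i\dot\alpha=\sum_{j\ne i}\frac{m_jr_j\sin(a_j-a_i)}{(q_{ij}^2-1)^{3/2}},\end{cases}$$ where $\mathbf y=(y_1,\dots,y_N)$, $\mathbf z=(z_1,\dots,z_N)$, $$H_i(\mathbf y,\mathbf z,u_i,v_i):=\frac{(y_iv_i-z_iu_i)^2+v_i^2-u_i^2}{z_i^2-y_i^2-1}+\frac{b^2(z_i^2-y_i^2-1)}{[\sum_{j=1}^Nm_j(z_j^2-y_j^2-1)]^2},$$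 $i=1,\dots,N$, and, for any $i,j\in\{1,\dots,N\}$, $$q_{ij}=(z_i^2-y_i^2-1)^{1/2}(z_j^2-y_j^2-1)^{1/2}\cos(a_i-a_j)+y_iy_j-z_iz_j.$$ If the quantities $q_{ij}$ are constant for all distinct indices $i,j\in\{1,\dots,N\}$, then the solution is a relative equilibrium. If $q_{ij}=\pm1$ for some distinct $i,j\in\{1,\dots,N\}$, then such solutions do not exist.
   Context: Masses $m_1,\dots,m_N>0$, $N\ge2$; dots denote $d/dt$; $\sum_{j\ne i}$ runs over $j\in\{1,\dots,N\}\setminus\{i\}$. $\mathbb H^3=\{(w,x,y,z): w^2+x^2+y^2-z^2=-1,\ z>0\}$ in Minkowski space $\mathbb R^{3,1}$, $\cdot$ is the Lorentz inner product of signature $(+,+,+,-)$, $\mathbf q_i=(w_i,x_i,y_i,z_i)$, $q_{ij}:=\mathbf q_i\cdot\mathbf q_j$, $\dot q_{ii}:=\dot{\mathbf q}_i\cdot\dot{\mathbf q}_i$. The curved $N$-body problem in $\mathbb H^3$ is the system $$\ddot{\mathbf q}_i=\sum_{j\ne i}\frac{m_j(\mathbf q_j+q_{ij}\mathbf q_i)}{(q_{ij}^2-1)^{3/2}}+\dot q_{ii}\mathbf q_i,\quad q_{ii}=-1,\quad i=1,\dots,N.$$ A negative elliptic rotopulsator is a solution of this system of the negative elliptic form described in the claim for which there are at least two indices $i\ne j$ with $q_{ij}$ not constant; if instead all $q_{ij}$, $i\ne j$, are constant, the solution is called a negative elliptic relative equilibrium.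
   Formalization: The r_i are taken nonnegative (polar radii), and the equivalence is stated for all r_i > 0, since H_i has denominator z_i^2-y_i^2-1 = r_i^2 and the system is undefined when some r_i vanishes (e.g. a body resting on the rotation axis). *)

(* Defs.v *)
From mathcomp Require Import all_boot all_order all_algebra.
From mathcomp Require Import all_classical all_reals all_analysis.

Set Implicit Arguments.
Unset Strict Implicit.
Unset Printing Implicit Defensive.

Import Order.TTheory GRing.Theory Num.Theory.
Import numFieldNormedType.Exports.

Local Open Scope ring_scope.
Local Open Scope classical_set_scope.

Definition constant_on (R : realType) (J : set R) (f : R -> R) : Prop :=
  exists c : R, forall t, J t -> f t = c.

Definition twice_derivable_on (R : realType) (V : normedModType R)
    (J : set R) (f : R -> V) : Prop :=
  forall t, J t -> derivable f t 1 /\ derivable f^`() t 1.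

(* Vectors of R^{3,1} are rows (w, x, y, z). *)
Definition lorentz (R : realType) (p q : 'rV[R]_4) : R :=
  p 0 0 * q 0 0 + p 0 1 * q 0 1 + p 0 2 * q 0 2 - p 0 3 * q 0 3.

Definition hyperbolic3 (R : realType) : set 'rV[R]_4 :=
  [set p | lorentz p p = -1 /\ 0 < p 0 3].

(* The common factor m_j / (q_ij^2 - 1)^(3/2) of the force terms; it is
   meaningful only where 1 < q_ij^2, a condition that the predicates below
   impose explicitly wherever this factor occurs in an equation. *)
Definition force_coef (R : realType) (mj qij : R) : R :=
  mj / (qij ^+ 2 - 1) `^ (3 / 2).

Definition curved_acceleration (R : realType) (N : nat) (m : 'I_N -> R)
    (q : 'I_N -> R -> 'rV[R]_4) (i : 'I_N) (t : R) : 'rV[R]_4 :=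
  let qij j := lorentz (q i t) (q j t) in
  let qdot := (q i)^`() t in
  \sum_(j < N | j != i) force_coef (m j) (qij j) *: (q j t + qij j *: q i t)
  + lorentz qdot qdot *: q i t.

Definition curved_solution (R : realType) (N : nat) (m : 'I_N -> R)
    (J : set R) (q : 'I_N -> R -> 'rV[R]_4) : Prop :=
  [/\ forall i, twice_derivable_on J (q i),
      forall i t, J t -> hyperbolic3 (q i t),
      forall i j t, J t -> i != j -> 1 < lorentz (q i t) (q j t) ^+ 2
    & forall i t, J t -> (q i)^`()^`() t = curved_acceleration m q i t].

Definition negative_elliptic_position (R : realType) (N : nat) (a : 'I_N -> R)
    (alpha : R -> R) (r y z : 'I_N -> R -> R) (i : 'I_N) (t : R) : 'rV[R]_4 :=
  \row_(k < 4) [:: r i t * cos (alpha t + a i);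
                   r i t * sin (alpha t + a i); y i t; z i t]`_k.

(* The r_i are polar radii, so nonnegative; this is what makes
   r_i = (z_i^2 - y_i^2 - 1)^(1/2). *)
Definition negative_elliptic_candidate (R : realType) (N : nat) (J : set R)
    (alpha : R -> R) (r y z : 'I_N -> R -> R) : Prop :=
  [/\ twice_derivable_on J (alpha : R -> R^o) /\
      (forall i, [/\ twice_derivable_on J (r i : R -> R^o),
                     twice_derivable_on J (y i : R -> R^o)
                   & twice_derivable_on J (z i : R -> R^o)]),
      ~ constant_on J alpha,
      forall i t, J t -> 0 <= r i t,
      forall i t, J t -> 1 <= z i t
    & forall i t, J t -> r i t ^+ 2 + y i t ^+ 2 - z i t ^+ 2 = -1].

Definition negative_elliptic_rotopulsator (R : realType) (N : nat)
    (m : 'I_N -> R) (J : set R) (a : 'I_N -> R) (alpha : R -> R)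
    (r y z : 'I_N -> R -> R) : Prop :=
  let q := negative_elliptic_position a alpha r y z in
  [/\ negative_elliptic_candidate J alpha r y z,
      curved_solution m J q
    & exists i j : 'I_N, i != j /\
        ~ constant_on J (fun t => lorentz (q i t) (q j t))].

Definition negative_elliptic_relative_equilibrium (R : realType) (N : nat)
    (m : 'I_N -> R) (J : set R) (a : 'I_N -> R) (alpha : R -> R)
    (r y z : 'I_N -> R -> R) : Prop :=
  let q := negative_elliptic_position a alpha r y z in
  [/\ negative_elliptic_candidate J alpha r y z,
      curved_solution m J q
    & forall i j : 'I_N, i != j ->
        constant_on J (fun t => lorentz (q i t) (q j t))].

Definition qfun (R : realType) (N : nat) (a : 'I_N -> R)
    (y z : 'I_N -> R -> R) (i j : 'I_N) (t : R) : R :=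
  Num.sqrt (z i t ^+ 2 - y i t ^+ 2 - 1)
  * Num.sqrt (z j t ^+ 2 - y j t ^+ 2 - 1) * cos (a i - a j)
  + y i t * y j t - z i t * z j t.

Definition Hfun (R : realType) (N : nat) (m : 'I_N -> R) (b : R)
    (y z u v : 'I_N -> R -> R) (i : 'I_N) (t : R) : R :=
  ((y i t * v i t - z i t * u i t) ^+ 2 + v i t ^+ 2 - u i t ^+ 2)
    / (z i t ^+ 2 - y i t ^+ 2 - 1)
  + b ^+ 2 * (z i t ^+ 2 - y i t ^+ 2 - 1)
    / (\sum_(j < N) m j * (z j t ^+ 2 - y j t ^+ 2 - 1)) ^+ 2.

(* The first two clauses say that the right-hand sides are defined. *)
Definition negative_elliptic_system (R : realType) (N : nat) (m : 'I_N -> R)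
    (b : R) (J : set R) (a : 'I_N -> R) (alpha : R -> R)
    (r y z u v : 'I_N -> R -> R) : Prop :=
  let F i j t := force_coef (m j) (qfun a y z i j t) in
  let rdot i := (r i)^`() in
  let alphadot := alpha^`() in
  let alphaddot := alpha^`()^`() in
  (forall i t, J t -> 0 < z i t ^+ 2 - y i t ^+ 2 - 1) /\
  (forall i j t, J t -> i != j -> 1 < qfun a y z i j t ^+ 2) /\
  forall i t, J t ->
  [/\ is_derive t 1 (y i : R -> R^o) (u i t),
      is_derive t 1 (z i : R -> R^o) (v i t),
      is_derive t 1 (u i : R -> R^o)
        (\sum_(j < N | j != i) F i j t * (y j t + qfun a y z i j t * y i t)
         + Hfun m b y z u v i t * y i t),
      is_derive t 1 (v i : R -> R^o)
        (\sum_(j < N | j != i) F i j t * (z j t + qfun a y z i j t * z i t)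
         + Hfun m b y z u v i t * z i t)
    & r i t * alphaddot t + 2 * rdot i t * alphadot t
      = \sum_(j < N | j != i) F i j t * r j t * sin (a j - a i)].

(* The condition on alpha together with the system, for some b != 0. *)
Definition negative_elliptic_equations (R : realType) (N : nat)
    (m : 'I_N -> R) (J : set R) (a : 'I_N -> R) (alpha : R -> R)
    (r y z : 'I_N -> R -> R) : Prop :=
  exists (b : R) (u v : 'I_N -> R -> R),
  [/\ b != 0,
      forall t, J t -> alpha^`() t = b / \sum_(j < N) m j * r j t ^+ 2
    & negative_elliptic_system m b J a alpha r y z u v].

(* Main.v *)
(** Resolve the (w, x)-part of each equation of motion along the radial and
tangential directions at the polar angle alpha + a_i. The tangential components
are the last line of the system; multiplied by m_i r_i and summed over i, their
right-hand sides cancel in pairs, so (sum_j m_j r_j^2) alpha' is a constant b,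
and b = 0 would make alpha constant. Differentiating r_i^2 = z_i^2 - y_i^2 - 1
once expresses r_i' through y_i, z_i, u_i, v_i and identifies H_i with the
squared Lorentz speed of q_i. Differentiating it twice shows that the radial
equation, absent from the system, follows from those for y_i and z_i after
division by r_i > 0. *)

Require Import Defs.
From mathcomp Require Import all_boot all_order all_algebra.
From mathcomp Require Import all_classical all_reals all_analysis.
From mathcomp Require Import ring lra.

Set Implicit Arguments.
Unset Strict Implicit.

Import Order.TTheory GRing.Theory Num.Theory.
Import numFieldNormedType.Exports.

Local Open Scope ring_scope.
Local Open Scope classical_set_scope.

(** * Calculus of curves on an open set of times *)

Lemma is_derive_derive1 (R : realType) (V : normedModType R) (f : R -> V)
    (t : R) (d : V) : is_derive t 1 f d -> f^`() t = d.
Proof. by move=> [_ <-]; rewrite derive1E. Qed.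

Lemma is_derive_derive1_on (R : realType) (V : normedModType R) (J : set R)
    (f f1 : R -> V) (t : R) (d : V) :
  open J -> J t -> (forall s, J s -> is_derive s 1 f (f1 s)) ->
  is_derive t 1 f1 d -> is_derive t 1 f^`() d.
Proof.
move=> J_open Jt df; apply: near_eq_is_derive.
apply: filterS (open_nbhs_nbhs (conj J_open Jt)) => s Js.
by rewrite (is_derive_derive1 (df s Js)).
Qed.

Lemma twice_derivable_onP (R : realType) (V : normedModType R) (J : set R)
    (f f1 f2 : R -> V) (J_open : open J)
    (df : forall t, J t -> is_derive t 1 f (f1 t))
    (df1 : forall t, J t -> is_derive t 1 f1 (f2 t)) :
  twice_derivable_on J f /\
  forall t, J t -> f^`() t = f1 t /\ f^`()^`() t = f2 t.
Proof.
have ddf t (Jt : J t) := is_derive_derive1_on J_open Jt df (df1 t Jt).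
split=> t Jt; split.
- by case: (df t Jt).
- by case: (ddf t Jt).
- exact: is_derive_derive1 (df t Jt).
- exact: is_derive_derive1 (ddf t Jt).
Qed.

Lemma twice_derivable_on_is_derive (R : realType) (V : normedModType R)
    (J : set R) (f : R -> V) (t : R) :
  twice_derivable_on J f -> J t ->
  is_derive t 1 f (f^`() t) /\ is_derive t 1 f^`() (f^`()^`() t).
Proof.
by move=> df Jt; case: (df t Jt) => d1 d2; split; rewrite derive1E; exact/derivableP.
Qed.

Lemma is_derive_row4 (R : realType) (f0 f1 f2 f3 : R -> R^o) (t : R)
    (d0 d1 d2 d3 : R) :
  is_derive t 1 f0 d0 -> is_derive t 1 f1 d1 ->
  is_derive t 1 f2 d2 -> is_derive t 1 f3 d3 ->
  is_derive t 1 (fun s => \row_(k < 4) [:: f0 s; f1 s; f2 s; f3 s]`_k)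
    (\row_(k < 4) [:: d0; d1; d2; d3]`_k).
Proof.
move=> D0 D1 D2 D3.
have D (i : 'I_1) (k : 'I_4) :
    is_derive t 1 ((fun s => (\row_(k < 4) [:: f0 s; f1 s; f2 s; f3 s]`_k) i k) : R -> R^o)
      ([:: d0; d1; d2; d3]`_k).
  under eq_fun do rewrite mxE.
  by case: k => [[|[|[|[|k]]]] ltk4].
have dM : derivable (fun s => \row_(k < 4) [:: f0 s; f1 s; f2 s; f3 s]`_k) t 1.
  by apply/derivable_mxP => i k; case: (D i k).
apply: DeriveDef => //; rewrite derive_mx//.
by apply/matrixP => i k; rewrite !mxE; case: (D i k).
Qed.

Lemma derive1_0_is_constant_on (R : realType) (J : set R) (f : R -> R^o) :
  is_interval J -> (forall t, J t -> is_derive t 1 f 0) -> constant_on J f.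
Proof.
move=> J_itv df.
suff le_eq s t : J s -> J t -> s <= t -> f t = f s.
  (* On an empty [J] any value serves as the constant. *)
  have [[t0 Jt0]|J0] := pselect (exists t, J t); last first.
    by exists 0 => t Jt; case: J0; exists t.
  by exists (f t0) => t Jt; case: (leP t0 t) => [|/ltW] le; [|symmetry]; exact: le_eq.
move=> Js Jt st.
have inJ u : u \in `[s, t]%R -> J u by rewrite in_itv /= => /J_itv; exact.
have [||u _] := @MVT_segment R f (cst 0) s t st.
- move=> u /subset_itv_oo_cc/inJ; exact: df.
- apply: derivable_within_continuous => u /inJ /df []//.
- by rewrite mul0r => /eqP; rewrite subr_eq0 => /eqP.
Qed.

(** * The rotating frame in the (w, x)-plane *)

(* The vector with radial component A and tangential component B at polar
   angle th in the (w, x)-plane. *)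
Definition polar_row (R : realType) (th A B Y Z : R) : 'rV[R]_4 :=
  \row_(k < 4) [:: A * cos th - B * sin th; A * sin th + B * cos th; Y; Z]`_k.

(** The radial unit vector turns into [th'] times the tangential one, and the tangential one into
    [- th'] times the radial one. Applied to position and then to velocity, this produces the
    centripetal and Coriolis terms. *)
Lemma is_derive_polar_row (R : realType) (th A B Y Z : R -> R^o) (t : R)
    (th' A' B' Y' Z' : R) :
  is_derive t 1 th th' -> is_derive t 1 A A' -> is_derive t 1 B B' ->
  is_derive t 1 Y Y' -> is_derive t 1 Z Z' ->
  is_derive t 1 (fun s => polar_row (th s) (A s) (B s) (Y s) (Z s))
    (polar_row (th t) (A' - B t * th') (B' + A t * th') Y' Z').
Proof.
move=> dth dA dB dY dZ.
have dcos : is_derive t 1 (fun s => cos (th s) : R^o) (- sin (th t) * th').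
  exact: (is_derive1_comp (is_derive_cos _)).
have dsin : is_derive t 1 (fun s => sin (th s) : R^o) (cos (th t) * th').
  exact: (is_derive1_comp (is_derive_sin _)).
apply: is_derive_row4 => //.
- by apply: is_derive_eq; rewrite /GRing.scale /=; ring.
- by apply: is_derive_eq; rewrite /GRing.scale /=; ring.
Qed.

Lemma polar_row_inj (R : realType) (th A B Y Z A' B' Y' Z' : R) :
  polar_row th A B Y Z = polar_row th A' B' Y' Z' <->
  [/\ A = A', B = B', Y = Y' & Z = Z'].
Proof.
split=> [/rowP E|[-> -> -> ->]//].
move: (E 0) (E 1) (E 2) (E 3); rewrite !mxE /= => E0 E1 E2 E3.
split=> //; have := cos2Dsin2 th => cs.
- rewrite -[A]mulr1 -[A']mulr1 -cs.
  (* The inverse rotation recovers the radial component, and below the tangential one. *)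
  transitivity ((A * cos th - B * sin th) * cos th
    + (A * sin th + B * cos th) * sin th); first ring.
  by rewrite E0 E1; ring.
- rewrite -[B]mulr1 -[B']mulr1 -cs.
  transitivity ((A * sin th + B * cos th) * cos th
    - (A * cos th - B * sin th) * sin th); first ring.
  by rewrite E0 E1; ring.
Qed.

Lemma lorentz_polar_row (R : realType) (th th' A B Y Z A' B' Y' Z' : R) :
  lorentz (polar_row th A B Y Z) (polar_row th' A' B' Y' Z') =
  (A * A' + B * B') * cos (th - th') + (A * B' - B * A') * sin (th - th')
  + Y * Y' - Z * Z'.
Proof. by rewrite /lorentz !mxE /= cosB sinB; ring. Qed.

Lemma negative_elliptic_positionE (R : realType) (N : nat) (a : 'I_N -> R)
    (alpha : R -> R) (r y z : 'I_N -> R -> R) (i : 'I_N) (t : R) :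
  negative_elliptic_position a alpha r y z i t =
  polar_row (alpha t + a i) (r i t) 0 (y i t) (z i t).
Proof. by apply/rowP => k; rewrite !mxE !mul0r subr0 addr0. Qed.

(** This is the shape of [curved_acceleration] seen from the frame of body i, with [d j] standing
    for [a j - a i]. The multiples of the position of body i are purely radial in the plane, so the
    tangential sum contains only the sines. *)
Lemma sum_polar_row (R : realType) (N : nat) (P : pred 'I_N)
    (F q d A Y Z : 'I_N -> R) (th A0 Y0 Z0 s : R) :
  \sum_(j < N | P j) F j *: (polar_row (th + d j) (A j) 0 (Y j) (Z j)
                             + q j *: polar_row th A0 0 Y0 Z0)
    + s *: polar_row th A0 0 Y0 Z0
  = polar_row th
      (\sum_(j < N | P j) F j * (A j * cos (d j) + q j * A0) + s * A0)
      (\sum_(j < N | P j) F j * A j * sin (d j))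
      (\sum_(j < N | P j) F j * (Y j + q j * Y0) + s * Y0)
      (\sum_(j < N | P j) F j * (Z j + q j * Z0) + s * Z0).
Proof.
apply/rowP => -[[|[|[|[|//]]]] ltk4]; rewrite !mxE summxE /=.
- rewrite mulrDl addrAC !mulr_suml -sumrB; congr (_ + _); last by ring.
  by apply: eq_bigr => j _; rewrite !mxE /= cosD; ring.
- rewrite mulrDl addrAC !mulr_suml -big_split; congr (_ + _); last by ring.
  by apply: eq_bigr => j _; rewrite !mxE /= sinD; ring.
- by congr (_ + _); apply: eq_bigr => j _; rewrite !mxE.
- by congr (_ + _); apply: eq_bigr => j _; rewrite !mxE.
Qed.

(** * The equations of motion in the rotating frame *)

Lemma negative_elliptic_radiusE (R : realType) (N : nat) (J : set R)
    (alpha : R -> R) (r y z : 'I_N -> R -> R) (i : 'I_N) (t : R) :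
  negative_elliptic_candidate J alpha r y z -> J t ->
  Num.sqrt (z i t ^+ 2 - y i t ^+ 2 - 1) = r i t.
Proof.
move=> [_ _ r_ge0 _ constr] Jt.
have -> : z i t ^+ 2 - y i t ^+ 2 - 1 = r i t ^+ 2 by have := constr i t Jt; lra.
by rewrite sqrtr_sqr ger0_norm ?r_ge0.
Qed.

Lemma lorentz_negative_elliptic_position (R : realType) (N : nat) (J : set R)
    (a : 'I_N -> R) (alpha : R -> R) (r y z : 'I_N -> R -> R)
    (i j : 'I_N) (t : R) :
  negative_elliptic_candidate J alpha r y z -> J t ->
  lorentz (negative_elliptic_position a alpha r y z i t)
          (negative_elliptic_position a alpha r y z j t) = qfun a y z i j t.
Proof.
move=> cand Jt; rewrite !negative_elliptic_positionE lorentz_polar_row /qfun.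
rewrite !(negative_elliptic_radiusE _ cand Jt) opprD addrACA subrr add0r.
by ring.
Qed.

(** The Lorentz square of the velocity of body i, whose planar part has radial speed r' and
    tangential speed r alpha'. *)
Definition polar_speed2 (R : realType) (N : nat) (alpha : R -> R)
    (r y z : 'I_N -> R -> R) (i : 'I_N) (t : R) : R :=
  (r i)^`()%classic t ^+ 2 + (r i t * alpha^`()%classic t) ^+ 2
  + (y i)^`()%classic t ^+ 2 - (z i)^`()%classic t ^+ 2.

(** Velocity, acceleration and force are all written in the frame at angle [alpha t + a i], where
    equality of vectors is equality of components. Membership in the hyperboloid comes from the
    candidate itself. *)
Lemma curved_solution_polarP (R : realType) (N : nat) (m : 'I_N -> R)
    (J : set R) (a : 'I_N -> R) (alpha : R -> R) (r y z : 'I_N -> R -> R)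
    (J_open : open J) (cand : negative_elliptic_candidate J alpha r y z) :
  curved_solution m J (negative_elliptic_position a alpha r y z) <->
  (forall i j t, J t -> i != j -> 1 < qfun a y z i j t ^+ 2) /\
  forall i t, J t ->
  let F j := force_coef (m j) (qfun a y z i j t) in
  let S := polar_speed2 alpha r y z i t in
  [/\ (r i)^`()^`()%classic t - r i t * alpha^`()%classic t ^+ 2 =
        \sum_(j < N | j != i)
          F j * (r j t * cos (a j - a i) + qfun a y z i j t * r i t) + S * r i t,
      r i t * alpha^`()^`()%classic t + 2 * (r i)^`()%classic t * alpha^`()%classic t =
        \sum_(j < N | j != i) F j * r j t * sin (a j - a i),
      (y i)^`()^`()%classic t =
        \sum_(j < N | j != i) F j * (y j t + qfun a y z i j t * y i t)
        + S * y i t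
    & (z i)^`()^`()%classic t =
        \sum_(j < N | j != i) F j * (z j t + qfun a y z i j t * z i t)
        + S * z i t].
Proof.
have [[dalpha dryz] _ r_ge0 z_ge1 constr] := cand.
set q := negative_elliptic_position a alpha r y z.
(* [q1] and [q2] are the velocity and the acceleration in the rotating frame. *)
pose q1 i t := polar_row (alpha t + a i) ((r i)^`()%classic t)
  (r i t * alpha^`()%classic t) ((y i)^`()%classic t) ((z i)^`()%classic t).
pose q2 i t := polar_row (alpha t + a i)
  ((r i)^`()^`()%classic t - r i t * alpha^`()%classic t ^+ 2)
  (r i t * alpha^`()^`()%classic t + 2 * (r i)^`()%classic t * alpha^`()%classic t)
  ((y i)^`()^`()%classic t) ((z i)^`()^`()%classic t).
have dth i t : J t -> is_derive t 1 (fun s => alpha s + a i : R^o) (alpha^`()%classic t).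
  move=> /(twice_derivable_on_is_derive dalpha)[d1 _].
  by apply: is_derive_eq; rewrite addr0.
have dq i t : J t -> is_derive t 1 (q i) (q1 i t).
  move=> Jt; have [dr dy dz] := dryz i.
  have [r1 _] := twice_derivable_on_is_derive dr Jt.
  have [y1 _] := twice_derivable_on_is_derive dy Jt.
  have [z1 _] := twice_derivable_on_is_derive dz Jt.
  have -> : q i = fun s => polar_row (alpha s + a i) (r i s) (cst 0 s) (y i s) (z i s).
    by apply/funext => s; exact: negative_elliptic_positionE.
  apply: is_derive_eq.
    exact: (is_derive_polar_row (dth i t Jt) r1 (is_derive_cst _ _ _) y1 z1).
  by rewrite /q1 mul0r subr0 add0r.
have dq1 i t : J t -> is_derive t 1 (q1 i) (q2 i t).
  move=> Jt; have [dr dy dz] := dryz i.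
  have [r1 r2] := twice_derivable_on_is_derive dr Jt.
  have [_ y2] := twice_derivable_on_is_derive dy Jt.
  have [_ z2] := twice_derivable_on_is_derive dz Jt.
  have [_ al2] := twice_derivable_on_is_derive dalpha Jt.
  apply: is_derive_eq.
    exact: (is_derive_polar_row (dth i t Jt) r2 (is_deriveM r1 al2) y2 z2).
  by rewrite /q2 mulrfctE /GRing.scale /=; congr polar_row; ring.
have dqP i := twice_derivable_onP J_open (dq i) (dq1 i).
have accE i t : J t -> curved_acceleration m q i t =
    let F j := force_coef (m j) (qfun a y z i j t) in
    let S := polar_speed2 alpha r y z i t in
    polar_row (alpha t + a i)
      (\sum_(j < N | j != i)
          F j * (r j t * cos (a j - a i) + qfun a y z i j t * r i t) + S * r i t)
      (\sum_(j < N | j != i) F j * r j t * sin (a j - a i))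
      (\sum_(j < N | j != i) F j * (y j t + qfun a y z i j t * y i t)
        + S * y i t)
      (\sum_(j < N | j != i) F j * (z j t + qfun a y z i j t * z i t)
        + S * z i t).
  move=> Jt; rewrite /= -sum_polar_row /curved_acceleration.
  rewrite ((dqP i).2 t Jt).1 lorentz_polar_row subrr cos0 sin0.
  congr (_ + _ *: _); last exact: negative_elliptic_positionE.
    apply: eq_bigr => j _; rewrite (lorentz_negative_elliptic_position _ _ _ cand Jt).
    (* The angle of body j is that of body i plus [a j - a i]. *)
    by rewrite /q !negative_elliptic_positionE -addrA subrKC.
  by rewrite /polar_speed2; ring.
split=> [[_ _ sep eqn]|[sep eqn]].
  split=> [i j t Jt ij|i t Jt].
    by have := sep i j t Jt ij; rewrite (lorentz_negative_elliptic_position _ _ _ cand Jt).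
  apply/(@polar_row_inj _ (alpha t + a i)); have /= <- := accE i t Jt.
  by rewrite -eqn// ((dqP i).2 t Jt).2.
split=> [i|i t Jt|i j t Jt ij|i t Jt].
- exact: (dqP i).1.
- split=> /=; last by rewrite mxE /= (lt_le_trans ltr01)// z_ge1.
  rewrite /q negative_elliptic_positionE lorentz_polar_row subrr cos0 sin0.
  by rewrite -(constr i t Jt); ring.
- by rewrite (lorentz_negative_elliptic_position _ _ _ cand Jt) sep.
- by rewrite ((dqP i).2 t Jt).2 accE//; apply/polar_row_inj/eqn.
Qed.

(** * Consequences of the hyperboloid constraint *)

Lemma derive_constant_on (R : realType) (J : set R) (f : R -> R^o) (c t d : R) :
  open J -> J t -> (forall s, J s -> f s = c) -> is_derive t 1 f d -> d = 0.
Proof.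
move=> J_open Jt fc df.
have [_ <-] : is_derive t 1 (cst c : R -> R^o) d.
  apply: near_eq_is_derive df.
  exact: filterS fc (open_nbhs_nbhs (conj J_open Jt)).
exact: derive_cst.
Qed.

Lemma negative_elliptic_constraint_derive (R : realType) (N : nat) (J : set R)
    (alpha : R -> R) (r y z : 'I_N -> R -> R) (i : 'I_N) (t : R) :
  open J -> negative_elliptic_candidate J alpha r y z -> J t ->
  r i t * (r i)^`()%classic t + y i t * (y i)^`()%classic t
    - z i t * (z i)^`()%classic t = 0 /\
  (r i)^`()%classic t ^+ 2 + r i t * (r i)^`()^`()%classic t
    + ((y i)^`()%classic t ^+ 2 + y i t * (y i)^`()^`()%classic t)
    - ((z i)^`()%classic t ^+ 2 + z i t * (z i)^`()^`()%classic t) = 0.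
Proof.
move=> J_open [[_ /(_ i)[dr dy dz]] _ _ _ constr].
(* Half the derivative of the constraint; its vanishing on all of [J] allows a second
   differentiation. *)
pose g s := r i s * (r i)^`()%classic s + y i s * (y i)^`()%classic s
    - z i s * (z i)^`()%classic s.
have g0 s : J s -> g s = 0.
  move=> Js.
  have [r1 _] := twice_derivable_on_is_derive dr Js.
  have [y1 _] := twice_derivable_on_is_derive dy Js.
  have [z1 _] := twice_derivable_on_is_derive dz Js.
  have := derive_constant_on J_open Js (fun u Ju => constr i u Ju)
    (is_deriveB (is_deriveD (is_deriveX 2 r1) (is_deriveX 2 y1)) (is_deriveX 2 z1)).
  by rewrite /g /GRing.scale /=; lra.
move=> Jt; split; first exact: g0.
have [r1 r2] := twice_derivable_on_is_derive dr Jt.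
have [y1 y2] := twice_derivable_on_is_derive dy Jt.
have [z1 z2] := twice_derivable_on_is_derive dz Jt.
rewrite -[RHS](derive_constant_on J_open Jt g0
  (is_deriveB (is_deriveD (is_deriveM r1 r2) (is_deriveM y1 y2)) (is_deriveM z1 z2))).
rewrite /GRing.scale /=.
(* Derivatives become plain variables, leaving a polynomial identity. *)
move: (r i t) ((r i)^`()%classic t) ((r i)^`()^`()%classic t) => x x1 x2.
move: (y i t) ((y i)^`()%classic t) ((y i)^`()^`()%classic t) => p p1 p2.
move: (z i t) ((z i)^`()%classic t) ((z i)^`()^`()%classic t) => w w1 w2.
by ring.
Qed.

(** The second term of H_i is (r_i alpha')^2 by the formula for alpha'. In the first, r r' = z v - y
    u and (y v - z u)^2 - (z v - y u)^2 = (z^2 - y^2)(u^2 - v^2) give r'^2 + u^2 - v^2 after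
    division by r^2. *)
Lemma Hfun_polar_speed2 (R : realType) (N : nat) (m : 'I_N -> R) (b : R)
    (J : set R) (alpha : R -> R) (r y z u v : 'I_N -> R -> R) (i : 'I_N) (t : R) :
  open J -> negative_elliptic_candidate J alpha r y z -> J t ->
  alpha^`()%classic t = b / \sum_(j < N) m j * r j t ^+ 2 -> r i t != 0 ->
  (y i)^`()%classic t = u i t -> (z i)^`()%classic t = v i t ->
  Hfun m b y z u v i t = polar_speed2 alpha r y z i t.
Proof.
move=> J_open cand Jt alphaE r_neq0 yE zE; rewrite /Hfun /polar_speed2 alphaE yE zE.
have [+ _] := negative_elliptic_constraint_derive i J_open cand Jt.
have [_ _ _ _ constr] := cand.
have r2E j : z j t ^+ 2 - y j t ^+ 2 - 1 = r j t ^+ 2 by have := constr j t Jt; lra.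
rewrite r2E; under eq_bigr do rewrite r2E; rewrite yE zE => c1.
have {}c1 : r i t * (r i)^`()%classic t = z i t * v i t - y i t * u i t by lra.
have -> : ((y i t * v i t - z i t * u i t) ^+ 2 + v i t ^+ 2 - u i t ^+ 2)
    / r i t ^+ 2 = (r i)^`()%classic t ^+ 2 + u i t ^+ 2 - v i t ^+ 2.
  apply: (mulIf (expf_neq0 2 r_neq0)); rewrite divfK ?expf_neq0//.
  by rewrite -[in RHS]addrA [RHS]mulrDl -exprMn [_ * r i t]mulrC c1 -(r2E i); ring.
by rewrite exprMn expr_div_n; ring.
Qed.

(** * Conservation of angular momentum *)

Lemma sum_antisymmetric (R : realType) (N : nat) (f : 'I_N -> 'I_N -> R) :
  (forall i j, f i j = - f j i) ->
  \sum_(i < N) \sum_(j < N | j != i) f i j = 0.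
Proof.
move=> fN; set S := LHS; suff: S = - S by lra.
rewrite {1}/S (exchange_big_dep xpredT)//= -sumrN; apply: eq_bigr => i _.
rewrite -sumrN; apply: eq_big => [j|j _]; first by rewrite eq_sym.
exact: fN.
Qed.

Lemma qfunC (R : realType) (N : nat) (a : 'I_N -> R) (y z : 'I_N -> R -> R)
    (i j : 'I_N) (t : R) : qfun a y z i j t = qfun a y z j i t.
Proof.
by rewrite /qfun -[in LHS]cosN opprB; ring.
Qed.

(* Each pair (i, j) exerts opposite torques on i and j. *)
Lemma angular_momentum_constant (R : realType) (N : nat) (m : 'I_N -> R)
    (J : set R) (a : 'I_N -> R) (alpha : R -> R) (r y z : 'I_N -> R -> R) :
  is_interval J -> negative_elliptic_candidate J alpha r y z ->
  (forall i t, J t ->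
     r i t * alpha^`()^`()%classic t
       + 2 * (r i)^`()%classic t * alpha^`()%classic t =
     \sum_(j < N | j != i)
        force_coef (m j) (qfun a y z i j t) * r j t * sin (a j - a i)) ->
  constant_on J
    (fun t => (\sum_(j < N) m j * r j t ^+ 2) * alpha^`()%classic t).
Proof.
move=> J_itv [[dalpha dryz] _ _ _ _] torque.
apply: derive1_0_is_constant_on => // t Jt.
have [_ al2] := twice_derivable_on_is_derive dalpha Jt.
have dI : is_derive t 1 (fun s => \sum_(j < N) m j * r j s ^+ 2 : R^o)
    (\sum_(j < N) m j * (2 * r j t * (r j)^`()%classic t)).
  rewrite -fct_sumE; apply: is_derive_sum => j.
  have [dr _ _] := dryz j; have [r1 _] := twice_derivable_on_is_derive dr Jt.
  rewrite (_ : (fun s => _) = cst (m j) * r j ^+ 2); last first.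
    by apply/funext => s; rewrite mulrfctE exprfctE.
  by apply: is_derive_eq; rewrite /GRing.scale /=; ring.
apply: is_derive_eq.
(* The derivative of m_i r_i^2 alpha' is m_i r_i (r_i alpha'' + 2 r_i' alpha'), that is, m_i r_i
   times the tangential force. *)
transitivity (\sum_(i < N) \sum_(j < N | j != i) m i * r i t *
    (force_coef (m j) (qfun a y z i j t) * r j t * sin (a j - a i))).
  rewrite /GRing.scale /= mulr_suml mulr_sumr -big_split /=.
  by apply: eq_bigr => i _; rewrite -mulr_sumr -torque//; ring.
(* Only the sine changes sign under exchange; the factor m_i m_j r_i r_j / (q_ij^2 - 1)^(3/2) is
   symmetric. *)
apply: sum_antisymmetric => i j; rewrite -(opprB (a j)) sinN (qfunC _ _ _ i j).
by rewrite /force_coef; ring.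
Qed.

(** * The radial equation and the two implications *)

(** Each vector q_j + q_ij q_i is Lorentz orthogonal to q_i, whatever its coefficient [F j]. Hence
    the y and z forces determine r_i times the radial force, while the twice differentiated
    constraint determines r_i r_i''. *)
Lemma radial_equation_of_constraint (R : realType) (N : nat) (J : set R)
    (a : 'I_N -> R) (alpha : R -> R) (r y z : 'I_N -> R -> R) (i : 'I_N) (t : R)
    (F : 'I_N -> R) :
  open J -> negative_elliptic_candidate J alpha r y z -> J t -> r i t != 0 ->
  let S := polar_speed2 alpha r y z i t in
  (y i)^`()^`()%classic t =
    \sum_(j < N | j != i) F j * (y j t + qfun a y z i j t * y i t) + S * y i t ->
  (z i)^`()^`()%classic t =
    \sum_(j < N | j != i) F j * (z j t + qfun a y z i j t * z i t) + S * z i t ->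
  (r i)^`()^`()%classic t - r i t * alpha^`()%classic t ^+ 2 =
    \sum_(j < N | j != i)
       F j * (r j t * cos (a j - a i) + qfun a y z i j t * r i t) + S * r i t.
Proof.
move=> J_open cand Jt r_neq0 S yE zE.
have [_ ] := negative_elliptic_constraint_derive i J_open cand Jt.
have [_ _ _ _ /(_ i t Jt) constr] := cand.
have r2E : r i t ^+ 2 = z i t ^+ 2 - y i t ^+ 2 - 1.
  by move: constr; clear; lra.
(* The orthogonality to q_i, solved for the radial term. *)
have : z i t * (\sum_(j < N | j != i) F j * (z j t + qfun a y z i j t * z i t))
    - y i t * (\sum_(j < N | j != i) F j * (y j t + qfun a y z i j t * y i t))
    = r i t * \sum_(j < N | j != i)
       F j * (r j t * cos (a j - a i) + qfun a y z i j t * r i t).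
  rewrite !mulr_sumr -sumrB; apply: eq_bigr => j _.
  rewrite -[cos _]cosN opprB.
  have qE : r i t * r j t * cos (a i - a j)
      = qfun a y z i j t - y i t * y j t + z i t * z j t.
    by rewrite /qfun !(negative_elliptic_radiusE _ cand Jt); ring.
  transitivity (F j * (r i t * r j t * cos (a i - a j)
    + qfun a y z i j t * r i t ^+ 2)); last ring.
  by rewrite r2E qE; ring.
rewrite {}yE {}zE.
set Sz := \sum_(j < N | j != i) _; set Sy := \sum_(j < N | j != i) _.
set Sr := \sum_(j < N | j != i) _ => sumE c2.
apply: (mulfI r_neq0).
have sE : S = (r i)^`()%classic t ^+ 2 + (r i t * alpha^`()%classic t) ^+ 2
  + (y i)^`()%classic t ^+ 2 - (z i)^`()%classic t ^+ 2 by [].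
(* With the constraint premultiplied by [S], what remains is linear in the monomials and within
   reach of [lra]. *)
have {constr} constrS : S * (r i t ^+ 2 + y i t ^+ 2 - z i t ^+ 2) = - S.
  by rewrite constr mulrN1.
move: constrS sumE c2 sE; move: S (r i t) (y i t) (z i t) Sy Sz Sr.
move: ((r i)^`()%classic t) ((y i)^`()%classic t) ((z i)^`()%classic t).
move: ((r i)^`()^`()%classic t) (alpha^`()%classic t).
by clear; move=> *; lra.
Qed.

Lemma rotopulsator_equations (R : realType) (N : nat) (m : 'I_N -> R)
    (J : set R) (a : 'I_N -> R) (alpha : R -> R) (r y z : 'I_N -> R -> R) :
  (0 < N)%N -> (forall i, 0 < m i) -> open J -> is_interval J ->
  negative_elliptic_candidate J alpha r y z ->
  (forall i t, J t -> 0 < r i t) ->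
  curved_solution m J (negative_elliptic_position a alpha r y z) ->
  negative_elliptic_equations m J a alpha r y z.
Proof.
move=> N_gt0 m_gt0 J_open J_itv cand r_gt0.
move=> /(curved_solution_polarP _ _ J_open cand)[sep eqn].
have [[dalpha dryz] alpha_nc _ _ constr] := cand.
have [i t Jt|b bE] := @angular_momentum_constant _ _ m J a alpha r y z J_itv cand.
  by have [] := eqn i t Jt.
(* One body off the axis already makes the moment of inertia positive. *)
have I_gt0 t : J t -> 0 < \sum_(j < N) m j * r j t ^+ 2.
  move=> Jt; rewrite (bigD1 (Ordinal N_gt0))//= ltr_pwDl//.
    by rewrite mulr_gt0// exprn_gt0 ?r_gt0.
  by apply: sumr_ge0 => j _; rewrite mulr_ge0 ?sqr_ge0// ltW.
have alphaE t : J t -> alpha^`()%classic t = b / \sum_(j < N) m j * r j t ^+ 2.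
  by move=> Jt; rewrite -(bE t Jt) mulrC mulKf// gt_eqF// I_gt0.
have b_neq0 : b != 0.
  apply/eqP => b0; apply: alpha_nc; apply: derive1_0_is_constant_on => // t Jt.
  have [d1 _] := twice_derivable_on_is_derive dalpha Jt.
  by move: d1; rewrite alphaE// b0 mul0r.
(* [b] is the conserved angular momentum; [u] and [v] are the velocities of y and z. *)
exists b, (fun i => (y i)^`()%classic), (fun i => (z i)^`()%classic).
split; [exact: b_neq0|exact: alphaE|split=> [i t Jt|]].
  have -> : z i t ^+ 2 - y i t ^+ 2 - 1 = r i t ^+ 2 by have := constr i t Jt; lra.
  by rewrite exprn_gt0 ?r_gt0.
split=> [|i t Jt]; first exact: sep.
have [_ dy dz] := dryz i; have [_ eqa eqy eqz] := eqn i t Jt.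
have [y1 y2] := twice_derivable_on_is_derive dy Jt.
have [z1 z2] := twice_derivable_on_is_derive dz Jt.
have r_neq0 : r i t != 0 by rewrite gt_eqF ?r_gt0.
rewrite (Hfun_polar_speed2 J_open cand Jt (alphaE t Jt) r_neq0 erefl erefl).
split; [exact: y1|exact: z1| | |exact: eqa].
- by rewrite -eqy; exact: y2.
- by rewrite -eqz; exact: z2.
Qed.

Lemma equations_curved_solution (R : realType) (N : nat) (m : 'I_N -> R)
    (J : set R) (a : 'I_N -> R) (alpha : R -> R) (r y z : 'I_N -> R -> R) :
  open J -> negative_elliptic_candidate J alpha r y z ->
  negative_elliptic_equations m J a alpha r y z ->
  curved_solution m J (negative_elliptic_position a alpha r y z).
Proof.
move=> J_open cand [b [u [v [b_neq0 alphaE [pos [sep eqn]]]]]].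
apply/(curved_solution_polarP _ _ J_open cand); split=> // i t Jt F S.
(* By the constraint, the positivity clause of the system says r_i^2 > 0. *)
have r_neq0 : r i t != 0.
  have [_ _ _ _ constr] := cand.
  by rewrite -sqrf_eq0 gt_eqF//; have := pos i t Jt; have := constr i t Jt; lra.
have dy s : J s -> is_derive s 1 (y i : R -> R^o) (u i s) by case/(eqn i).
have dz s : J s -> is_derive s 1 (z i : R -> R^o) (v i s) by case/(eqn i).
have [_ _ du dv eqa] := eqn i t Jt.
have HS : Hfun m b y z u v i t = S.
  apply: (Hfun_polar_speed2 J_open cand Jt (alphaE t Jt) r_neq0).
  - exact: is_derive_derive1 (dy t Jt).
  - exact: is_derive_derive1 (dz t Jt).
(* The derivatives of [u i] and [v i] are the second derivatives of [y i] and [z i], since the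
   first-order equations hold on all of the open set [J]. *)
have yE := is_derive_derive1 (is_derive_derive1_on J_open Jt dy du).
have zE := is_derive_derive1 (is_derive_derive1_on J_open Jt dz dv).
rewrite HS in yE zE; split=> //.
exact: (radial_equation_of_constraint J_open cand Jt r_neq0 yE zE).
Qed.

(** The equivalence concerns bodies off the axis r_i = 0, because H_i divides by r_i^2; the system
    carries this condition in its own first clause. *)
Theorem mainTheorem5 (R : realType) (N : nat) (m : 'I_N -> R) (J : set R)
    (a : 'I_N -> R) (alpha : R -> R) (r y z : 'I_N -> R -> R)
    (N_ge2 : (2 <= N)%N) (m_gt0 : forall i, 0 < m i)
    (J_open : open J) (J_itv : is_interval J)
    (cand : negative_elliptic_candidate J alpha r y z) :
  [/\ (forall i t, J t -> 0 < r i t) ->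
        (negative_elliptic_rotopulsator m J a alpha r y z <->
         negative_elliptic_equations m J a alpha r y z /\
         exists i j : 'I_N, i != j /\ ~ constant_on J (qfun a y z i j)),
      negative_elliptic_equations m J a alpha r y z ->
        (forall i j : 'I_N, i != j -> constant_on J (qfun a y z i j)) ->
        negative_elliptic_relative_equilibrium m J a alpha r y z
    & (exists i j : 'I_N, i != j /\
         exists2 t, J t & qfun a y z i j t = 1 \/ qfun a y z i j t = -1) ->
        ~ negative_elliptic_rotopulsator m J a alpha r y z /\
        ~ negative_elliptic_relative_equilibrium m J a alpha r y z].
Proof.
pose q := negative_elliptic_position a alpha r y z.
have constE i j : constant_on J (fun t => lorentz (q i t) (q j t)) <->
    constant_on J (qfun a y z i j).
  by split=> -[c cE]; exists c => t Jt;
    rewrite -(cE t Jt) (lorentz_negative_elliptic_position _ _ _ cand Jt).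
split=> [r_gt0|eqs qc|[i [j [ij [t Jt q1]]]]].
- split=> [[_ sol [i [j [ij nc]]]]|[eqs [i [j [ij nc]]]]].
    split; last by exists i, j; split=> // /constE.
    exact: (rotopulsator_equations (ltnW N_ge2)).
  split=> //; last by exists i, j; split=> // /constE.
  exact: equations_curved_solution.
- split=> // [|i j ij]; first exact: equations_curved_solution.
  exact/constE/qc.
(* The value 1 or -1 makes q_ij^2 = 1, a singularity of the force that [curved_solution]
   excludes. *)
- have no_sol : ~ curved_solution m J q.
    move=> [_ _ /(_ i j t Jt ij) + _].
    rewrite (lorentz_negative_elliptic_position _ _ _ cand Jt).
    by case: q1 => ->; rewrite ?sqrrN expr1n ltxx.
  by split=> -[_ /no_sol].
Qed.
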